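(* Let $n>1$ be an integer. Let $\mathfrak{M}$ be a $\Gamma$-ring containing a family $\{e_\alpha \mid \alpha\in\Lambda\}$, where each $e_\alpha$ is a $\gamma_\alpha$-idempotent (for some $\gamma_\alpha\in\Gamma$), which satisfies: (i) For each $\alpha\in\Lambda$ there are two $\mathfrak{M}$-additive maps $f_\alpha:\Gamma\times\mathfrak{M}\to\mathfrak{M}$ and $f'_\alpha:\mathfrak{M}\times\Gamma\to\mathfrak{M}$ satisfying $f_\alpha(\gamma_\alpha,a)=a-e_\alpha\gamma_\alpha a$ and $f'_\alpha(a,\gamma_\alpha)=a-a\gamma_\alpha e_\alpha$ for all $a\in\mathfrak{M}$, such that, denoting $f_\alpha\beta a=f_\alpha(\beta,a)$, $a\beta f_\alpha=f'_\alpha(a,\beta)$, $1_\alpha\beta a=e_\alpha\beta a+f_\alpha\beta a$, $a\beta 1_\alpha=a\beta e_\alpha+a\beta f_\alpha$ (so that formally $1_\alpha=e_\alpha+f_\alpha$), one has $(a\beta f_\alpha)\gamma b=a\beta(f_\alpha\gamma b)$ for all $a,b\in\mathfrak{M}$ and $\beta,\gamma\in\Gamma$. (ii) If $x\in\mathfrak{M}$ is such that $x\Gamma\mathfrak{M}=0$, then $x=0$. (iii) If $x\in\mathfrak{M}$ is such that $e_\alpha\Gamma\mathfrak{M}\Gamma x=0$ for all $\alpha\in\Lambda$, then $x=0$ (and hence $\mathfrak{M}\Gamma x=0$ implies $x=0$). (iv) For each $\alpha\in\Lambda$ and $x\in\mathfrak{M}$, if $(e_\alpha\gamma_\alpha x\gamma_\alpha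 e_\alpha)\Gamma\mathfrak{M}\Gamma(1_\alpha-e_\alpha)=0$, then $e_\alpha\gamma_\alpha x\gamma_\alpha e_\alpha=0$. Then any $n$-multiplicative isomorphism $(\varphi,\phi)$ of $\mathfrak{M}$ onto an arbitrary gamma ring is additive.
   Context: Let $\mathfrak{M}$ and $\Gamma$ be two (additively written) abelian groups. $\mathfrak{M}$ is called a $\Gamma$-ring (in the sense of Barnes) if there is a product $(x,\alpha,y)\mapsto x\alpha y$ on $\mathfrak{M}\times\Gamma\times\mathfrak{M}$ such that for all $x,y,z\in\mathfrak{M}$, $\alpha,\beta\in\Gamma$: $x\alpha y\in\mathfrak{M}$; $(x+y)\alpha z=x\alpha z+y\alpha z$ and $x\alpha(y+z)=x\alpha y+x\alpha z$; $x(\alpha+\beta)y=x\alpha y+x\beta y$; $(x\alpha y)\beta z=x\alpha(y\beta z)$. Longer products are thus written without parentheses. A gamma ring is a $\Delta$-ring $\mathfrak{G}$ for some abelian groups $\mathfrak{G},\Delta$. For $\gamma\in\Gamma$, a $\gamma$-idempotent is a nonzero element $e\in\mathfrak{M}$ with $e\gamma e=e$. A map $\Gamma\times\mathfrak{M}\to\mathfrak{M}$ or $\mathfrak{M}\times\Gamma\to\mathfrak{M}$ is $\mathfrak{M}$-additive if it is additive in its $\mathfrak{M}$-variable (for each fixed element of $\Gamma$). For subsets $\mathfrak{A},\mathfrak{B}\subseteq\mathfrak{M}$ and $\Theta\subseteq\Gamma$, $\mathfrak{A}\Theta\mathfrak{B}$ denotes the set of all finite sums $\sum_i a_i\gamma_i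 b_i$ with $a_i\in\mathfrak{A}$, $\gamma_i\in\Theta$, $b_i\in\mathfrak{B}$; a single element stands for the corresponding singleton. The symbol $1_\alpha-e_\alpha$ stands for $f_\alpha$, so $(e_\alpha\gamma_\alpha x\gamma_\alpha e_\alpha)\Gamma\mathfrak{M}\Gamma(1_\alpha-e_\alpha)=0$ means $f'_\alpha\big((e_\alpha\gamma_\alpha x\gamma_\alpha e_\alpha)\beta m,\gamma\big)=0$ for all $m\in\mathfrak{M}$, $\beta,\gamma\in\Gamma$. Let $\mathfrak{M}$ be a $\Gamma$-ring and $\mathfrak{G}$ a $\Delta$-ring (not necessarily with identity elements). An $n$-multiplicative isomorphism of $\mathfrak{M}$ onto $\mathfrak{G}$ is an ordered pair $(\varphi,\phi)$ where $\varphi:\mathfrak{M}\to\mathfrak{G}$ and $\phi:\Gamma\to\Delta$ are bijective mappings with $$\varphi(x_1\gamma_1x_2\gamma_2\cdots\gamma_{n-1}x_n)=\varphi(x_1)\phi(\gamma_1)\varphi(x_2)\phi(\gamma_2)\cdots\phi(\gamma_{n-1})\varphi(x_n)$$ for all $x_1,\dots,x_n\in\mathfrak{M}$ and $\gamma_1,\dots,\gamma_{n-1}\in\Gamma$. It is called additive when $\varphi(x+y)=\varphi(x)+\varphi(y)$ for all $x,y\in\mathfrak{M}$. *)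

(* Defs.v *)
From HB Require Import structures.
From mathcomp Require Import all_boot all_order all_algebra.
From mathcomp Require Import classical_sets.
Set Implicit Arguments.
Unset Strict Implicit.
Unset Printing Implicit Defensive.
Import GRing.Theory.
Local Open Scope classical_set_scope.
Local Open Scope ring_scope.

(* Gamma rings in the sense of Barnes; [gmul R x a y] is the product x a y. *)
Record gammaRing (M Gam : zmodType) := GammaRing {
  gmul : M -> Gam -> M -> M;
  gmulDl : forall (x y : M) (a : Gam) (z : M),
    gmul (x + y) a z = gmul x a z + gmul y a z;
  gmulDr : forall (x : M) (a : Gam) (y z : M),
    gmul x a (y + z) = gmul x a y + gmul x a z;
  gmulDm : forall (x : M) (a b : Gam) (y : M),
    gmul x (a + b) y = gmul x a y + gmul x b y;
  gmulA : forall (x : M) (a : Gam) (y : M) (b : Gam) (z : M),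
    gmul (gmul x a y) b z = gmul x a (gmul y b z)
}.

Definition gidempotent (M Gam : zmodType) (R : gammaRing M Gam)
    (g : Gam) (e : M) : Prop :=
  e <> 0 /\ gmul R e g e = e.

(* The set of all finite sums of products a g b, a in A, g in T, b in B;
   the empty sum is included, so the set always contains 0. *)
Definition gmulset (M Gam : zmodType) (R : gammaRing M Gam)
    (A : set M) (T : set Gam) (B : set M) : set M :=
  [set z | exists s : seq (M * Gam * M),
     (forall t, t \in s -> [/\ A t.1.1, T t.1.2 & B t.2]) /\
     z = \sum_(t <- s) gmul R t.1.1 t.1.2 t.2].

(* The maps f b a and f' a b play the role of the formal products (1 - e) b a
   and a b (1 - e); only additivity in the M-variable is required, not in the
   Gam-variable. *)
Definition gcomplement (M Gam : zmodType) (R : gammaRing M Gam)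
    (g : Gam) (e : M) (f : Gam -> M -> M) (f' : M -> Gam -> M) : Prop :=
  [/\ forall b : Gam, {morph f b : x y / x + y},
      forall b : Gam, {morph f'^~ b : x y / x + y},
      forall a : M, f g a = a - gmul R e g a,
      forall a : M, f' a g = a - gmul R a g e
    & forall (a b : M) (beta gamma : Gam),
        gmul R (f' a beta) gamma b = gmul R a beta (f gamma b)].

(* The product x g_1 x_1 ... g_k x_k with s = [:: (g_1, x_1); ...; (g_k, x_k)];
   it has k + 1 factors from M. *)
Definition glongmul (M Gam : zmodType) (R : gammaRing M Gam)
    (x : M) (s : seq (Gam * M)) : M :=
  foldl (fun y p => gmul R y p.1 p.2) x s.

Definition nmult_isomorphism (n : nat) (M Gam G Del : zmodType)
    (R : gammaRing M Gam) (S : gammaRing G Del)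
    (phi : M -> G) (psi : Gam -> Del) : Prop :=
  [/\ bijective phi, bijective psi
    & forall (x : M) (s : seq (Gam * M)), (size s).+1 = n ->
        phi (glongmul R x s) =
        glongmul S (phi x) [seq (psi p.1, phi p.2) | p <- s]].

(* Main.v *)
(** Martindale's argument.  Fix an idempotent [e] of the family.  Left factors
    [e] absorb the surplus of an [n]-fold product, so on [e M] the isomorphism
    behaves as if [n] were [2].  Hence a product with a fixed element preserves
    the relation [phi x = phi a + phi b], and whenever the images of [a] and
    [b] add up after the product, [x] and [a + b] have the same product.  Since
    the formal complements [f] split every product into two Peirce parts, this
    gives additivity first on sums of elements in different Peirce components;
    then, through
      [(e + p) (m + a) = m + p a]  for [m] in [e M], [p] in [e M (1 - e)] and
      [e a = 0],
    on [e M (1 - e)]; by (iv) on [e M]; and by (iii) everywhere. *)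
Require Import Defs.
From mathcomp Require Import all_boot all_order all_algebra.
From mathcomp Require Import classical_sets.
Import GRing.Theory.
Local Open Scope classical_set_scope.
Local Open Scope ring_scope.
Set Implicit Arguments.
Unset Strict Implicit.
Unset Printing Implicit Defensive.

Lemma morphD0 (U V : zmodType) (h : U -> V) :
  {morph h : x y / x + y} -> h 0 = 0.
Proof. by move=> hD; apply: (addIr (h 0)); rewrite -hD !add0r. Qed.

Lemma morphDB (U V : zmodType) (h : U -> V) :
  {morph h : x y / x + y} -> {morph h : x y / x - y}.
Proof. by move=> hD x y; apply: (addIr (h y)); rewrite -hD !subrK. Qed.

Lemma morph_iter (U : zmodType) (h : U -> U) k :
  {morph h : x y / x + y} -> {morph iter k h : x y / x + y}.
Proof. by move=> hD; elim: k => // k IHk x y /=; rewrite IHk hD. Qed.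

(** * Calculus of products in a gamma ring *)

Section GammaRingTheory.
Context (M Gam : zmodType) (R : gammaRing M Gam).
Local Notation "x *[ a ] y" := (gmul R x a y)
  (at level 40, left associativity, format "x  *[ a ]  y").

Lemma gmulDl_morph a y : {morph (fun x => x *[a] y) : x1 x2 / x1 + x2}.
Proof. by move=> x1 x2; rewrite gmulDl. Qed.

Lemma gmul0l a y : 0 *[a] y = 0.
Proof. exact: morphD0 (gmulDl_morph a y). Qed.

Lemma gmul0r x a : x *[a] 0 = 0.
Proof. exact: morphD0 (gmulDr R x a). Qed.

Lemma gmulBl x1 x2 a y : (x1 - x2) *[a] y = x1 *[a] y - x2 *[a] y.
Proof. exact: morphDB (gmulDl_morph a y) x1 x2. Qed.

Lemma gmulBr x a y1 y2 : x *[a] (y1 - y2) = x *[a] y1 - x *[a] y2.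
Proof. exact: morphDB (gmulDr R x a) y1 y2. Qed.

Lemma gmul_suml I (s : seq I) (F : I -> M) a y :
  (\sum_(i <- s) F i) *[a] y = \sum_(i <- s) F i *[a] y.
Proof.
by apply: (big_morph (fun x => x *[a] y) (gmulDl_morph a y)); rewrite gmul0l.
Qed.

Lemma glongmul_nseq k x a y (s : seq (Gam * M)) :
  glongmul R x (nseq k (a, x) ++ (a, y) :: s) =
  iter k.+1 (gmul R x a) (glongmul R y s).
Proof.
have mul_glongmul u c v t :
    glongmul R u ((c, v) :: t) = u *[c] glongmul R v t.
  by elim: t v => //= p t IHt v; rewrite -[in RHS]IHt /= gmulA.
elim: k => [|k IHk]; first exact: mul_glongmul.
by rewrite iterS -IHk -mul_glongmul.
Qed.

(** This lemma and the next let (ii) and (iii), stated with sets of finite sums, be used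
    elementwise. *)
Lemma gmulset1l_eq0 x :
  (forall b m, x *[b] m = 0) -> gmulset R [set x] setT setT = [set 0].
Proof.
move=> x0; apply/seteqP; split=> [z [s [sP ->]] | z ->] /=; last first.
  by exists [::]; rewrite big_nil.
by rewrite big_seq big1 // => t /sP [/= ->]; rewrite x0.
Qed.

Lemma gmulset_ideal_eq0 e x :
  (forall b m c, e *[b] m *[c] x = 0) ->
  gmulset R (gmulset R [set e] setT setT) setT [set x] = [set 0].
Proof.
move=> x0; apply/seteqP; split=> [z [s [sP ->]] | z ->] /=; last first.
  by exists [::]; rewrite big_nil.
rewrite big_seq big1 // => t /sP [[s' [s'P ->]] _ /= ->].
rewrite gmul_suml big_seq big1 // => t' /s'P [/= -> _ _].
by rewrite x0.
Qed.

End GammaRingTheory.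

(** * Reduction of [n] factors to two *)

Section NMultIsomorphism.
Context (n : nat) (M Gam G Del : zmodType).
Context (R : gammaRing M Gam) (S : gammaRing G Del).
Context (phi : M -> G) (psi : Gam -> Del).
Hypothesis n_gt1 : (1 < n)%N.
Hypothesis iso : nmult_isomorphism n R S phi psi.
Local Notation "x *[ a ] y" := (gmul R x a y)
  (at level 40, left associativity, format "x  *[ a ]  y").

(** Accounts for the [n - 2] factors left over when two factors carry the content. *)
Let pad e g := iter (n - 2) (gmul S (phi e) (psi g)).

Let padD e g : {morph pad e g : x y / x + y}.
Proof. by apply: morph_iter => x y; rewrite gmulDr. Qed.

(** Since [e] fixes [v], putting [n - 2] copies of [e] in front of [v] leaves the product unchanged
    and gives it exactly [n] factors. *)
Lemma nmult_pad e g v d u : e *[g] v = v ->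
  phi (v *[d] u) = pad e g (gmul S (phi v) (psi d) (phi u)).
Proof.
move=> ev; have [_ _ phiM] := iso.
have ek k : iter k (gmul R e g) (v *[d] u) = v *[d] u.
  by elim: k => //= k ->; rewrite -gmulA ev.
(* For [n = 2] no copy of [e] occurs; for [n = k.+3] the leading [e] is followed by [k] more. *)
rewrite /pad; case: n n_gt1 phiM => [|[|[|k]]] // _ phiM.
  exact: (phiM v [:: (d, u)]).
have /= := phiM e (nseq k (g, e) ++ (g, v) :: [:: (d, u)]).
rewrite map_cat map_nseq /= !glongmul_nseq ek; apply.
by rewrite size_cat size_nseq addn2.
Qed.

Lemma nmult_inj : injective phi.
Proof. by have [/bij_inj] := iso. Qed.

Lemma nmult0 : phi 0 = 0.
Proof.
have [[psi' _ phiK] _ _] := iso.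
have pad0 : pad 0 0 0 = 0 by exact: morphD0 (@padD 0 0).
(* Here [psi'] is the inverse of [phi], so the right factor [psi' 0] has image 0. *)
rewrite -[X in phi X](gmul0l R 0 (psi' 0)).
by rewrite (@nmult_pad 0 0) ?gmul0l // phiK gmul0r pad0.
Qed.

Lemma nmult_add_exists a b : exists x, phi x = phi a + phi b.
Proof. by have [[phi' _ phiK] _ _] := iso; exists (phi' (phi a + phi b)). Qed.

Lemma nmultDr e g v d a b x : e *[g] v = v ->
  phi x = phi a + phi b ->
  phi (v *[d] x) = phi (v *[d] a) + phi (v *[d] b).
Proof.
by move=> ev xab; rewrite !(@nmult_pad e g) // xab gmulDr padD.
Qed.

Lemma nmultDl e g d a b x v :
  e *[g] a = a -> e *[g] b = b -> e *[g] x = x ->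
  phi x = phi a + phi b ->
  phi (x *[d] v) = phi (a *[d] v) + phi (b *[d] v).
Proof.
by move=> ea eb ex xab; rewrite !(@nmult_pad e g) // xab gmulDl padD.
Qed.

Lemma nmult_add0 a x : phi x = phi a + phi 0 -> x = a.
Proof. by rewrite nmult0 addr0 => /nmult_inj. Qed.

Lemma nmult_0add a x : phi x = phi 0 + phi a -> x = a.
Proof. by rewrite nmult0 add0r => /nmult_inj. Qed.

(** * Formal complements and Peirce components *)

Context (Lambda : Type) (e : Lambda -> M) (g : Lambda -> Gam).
Context (f : Lambda -> Gam -> M -> M) (f' : Lambda -> M -> Gam -> M).
Hypothesis e_idem : forall i, gidempotent R (g i) (e i).
Hypothesis f_compl : forall i, gcomplement R (g i) (e i) (f i) (f' i).
Hypothesis faithr : forall x, (forall b m, x *[b] m = 0) -> x = 0.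
Hypothesis faithl :
  forall x, (forall i b m c, e i *[b] m *[c] x = 0) -> x = 0.
Hypothesis corner0 : forall i x,
  (forall m b c, f' i (e i *[g i] x *[g i] e i *[b] m) c = 0) ->
  e i *[g i] x *[g i] e i = 0.

Let ee i : e i *[g i] e i = e i.
Proof. by have [] := e_idem i. Qed.

Let fgE i a : f i (g i) a = a - e i *[g i] a.
Proof. by have [] := f_compl i. Qed.

Let f'gE i a : f' i a (g i) = a - a *[g i] e i.
Proof. by have [] := f_compl i. Qed.

Let mulf i a b c d : f' i a c *[d] b = a *[c] f i d b.
Proof. by have [_ _ _ _] := f_compl i; apply. Qed.

Lemma gmul_inj_r x y : (forall b m, x *[b] m = y *[b] m) -> x = y.
Proof.
move=> xy; apply: subr0_eq; apply: faithr => b m.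
by rewrite gmulBl xy subrr.
Qed.

Lemma gmul_inj_l x y :
  (forall i b m c, e i *[b] m *[c] x = e i *[b] m *[c] y) -> x = y.
Proof.
move=> xy; apply: subr0_eq; apply: faithl => i b m c.
by rewrite gmulBr xy subrr.
Qed.

Lemma idem_mulA i b m : e i *[g i] (e i *[b] m) = e i *[b] m.
Proof. by rewrite -gmulA ee. Qed.

Lemma idem_mul_compl i b m : e i *[g i] f i b m = 0.
Proof. by rewrite -mulf f'gE ee subrr gmul0l. Qed.

(** By mixed associativity both sides agree after any right multiplication, so (ii) applies. *)
Lemma compl_mulA i x b s c : x *[b] f' i s c = f' i (x *[b] s) c.
Proof. by apply: gmul_inj_r => d m; rewrite mulf !gmulA mulf. Qed.

Lemma nmult_add_stable i a b x :
  e i *[g i] a = a -> e i *[g i] b = b -> phi x = phi a + phi b ->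
  e i *[g i] x = x.
Proof.
by move=> ea eb xab; apply: nmult_inj; rewrite xab (nmultDr _ (ee i) xab) ea eb.
Qed.

Lemma nmultD_11_12 i a b :
  e i *[g i] a = a -> a *[g i] e i = a ->
  e i *[g i] b = b -> b *[g i] e i = 0 ->
  phi (a + b) = phi a + phi b.
Proof.
move=> ea ae eb be; have [x xab] := nmult_add_exists a b.
have ex := nmult_add_stable ea eb xab.
have xe : x *[g i] e i = a.
  by apply: nmult_add0; rewrite (nmultDl _ _ ea eb ex xab) ae be.
(* The complement is no element of [M]; a further right factor turns it into the genuine element
   [f i d m], to which [nmultDl] applies. *)
have xf : f' i x (g i) = b.
  apply: gmul_inj_r => d m; rewrite mulf; apply: nmult_0add.
  rewrite (nmultDl _ _ ea eb ex xab) -mulf f'gE ae subrr gmul0l.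
  by rewrite -[b *[_] f _ _ _]mulf f'gE be subr0.
by rewrite -xab -[x](subrK (x *[g i] e i)) -f'gE xf xe addrC.
Qed.

Lemma nmultD_1_2 i m a :
  e i *[g i] m = m -> e i *[g i] a = 0 -> phi (m + a) = phi m + phi a.
Proof.
move=> em ea; have [x xma] := nmult_add_exists m a.
have ex : e i *[g i] x = m.
  by apply: nmult_add0; rewrite (nmultDr _ (ee i) xma) em ea.
have fx : f i (g i) x = a.
  rewrite -[RHS]subr0 -[in RHS]ea -fgE.
  (* Dually, (iii) supplies left factors; moving the complement into them gives elements that [e j]
     still fixes, as [nmultDr] requires. *)
  apply: gmul_inj_l => j b r c; rewrite -!mulf; apply: nmult_0add.
  have stable : e j *[g j] f' i (e j *[b] r) c = f' i (e j *[b] r) c.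
    by rewrite compl_mulA idem_mulA.
  rewrite (nmultDr _ stable xma); congr (phi _ + _).
  by rewrite mulf fgE em subrr gmul0r.
by rewrite -xma -[x](subrK (e i *[g i] x)) -fgE fx ex addrC.
Qed.

Lemma nmultD_1_122 i m p a :
  e i *[g i] m = m -> e i *[g i] p = p -> p *[g i] e i = 0 ->
  e i *[g i] a = 0 ->
  phi (m + p *[g i] a) = phi m + phi (p *[g i] a).
Proof.
move=> em ep pe ea.
have pm : p *[g i] m = 0 by rewrite -em -gmulA pe gmul0l.
have eep : e i *[g i] (e i + p) = e i + p by rewrite gmulDr ee ep.
have -> : m + p *[g i] a = (e i + p) *[g i] (m + a).
  by rewrite gmulDl !gmulDr em ea pm addr0 add0r.
(* The images of both factors split by the two preceding cases; the product is expanded in [G] and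
   each term is pulled back. *)
rewrite (nmult_pad _ _ eep) (nmultD_11_12 (ee i) (ee i) ep pe).
rewrite (nmultD_1_2 em ea) gmulDl !gmulDr !padD.
rewrite -!(nmult_pad _ _ (ee i)) -!(nmult_pad _ _ ep).
by rewrite em ea pm nmult0 addr0 add0r.
Qed.

Lemma nmult_add_compl i a b x :
  e i *[g i] a = a -> e i *[g i] b = b -> phi x = phi a + phi b ->
  f' i x (g i) = f' i (a + b) (g i).
Proof.
move=> ea eb xab; have ex := nmult_add_stable ea eb xab.
apply: gmul_inj_r => d m; rewrite !mulf; apply: nmult_inj.
(* As [e i] annihilates [f i d m], only the part of [b] in [e M (1 - e)] matters; it serves as [p]
   in [nmultD_1_122]. *)
have fb : b *[g i] f i d m = f' i b (g i) *[g i] f i d m.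
  by rewrite f'gE gmulBl gmulA idem_mul_compl gmul0r subr0.
rewrite (nmultDl _ _ ea eb ex xab) gmulDl fb; apply/esym/nmultD_1_122.
- by rewrite -gmulA ea.
- by rewrite f'gE gmulBr -gmulA eb.
- by rewrite f'gE gmulBl gmulA ee subrr.
- exact: idem_mul_compl.
Qed.

Lemma nmultD_12 i a b :
  e i *[g i] a = a -> a *[g i] e i = 0 ->
  e i *[g i] b = b -> b *[g i] e i = 0 ->
  phi (a + b) = phi a + phi b.
Proof.
move=> ea ae eb be; have [x xab] := nmult_add_exists a b.
have ex := nmult_add_stable ea eb xab.
have xe : x *[g i] e i = 0.
  by apply: nmult_add0; rewrite (nmultDl _ _ ea eb ex xab) ae be.
rewrite -xab; congr phi; have := nmult_add_compl ea eb xab.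
by rewrite !f'gE gmulDl xe ae be addr0 !subr0.
Qed.

Lemma nmultD_1 i a b :
  e i *[g i] a = a -> e i *[g i] b = b -> phi (a + b) = phi a + phi b.
Proof.
move=> ea eb; have [x xab] := nmult_add_exists a b.
have ex := nmult_add_stable ea eb xab.
have f'D c : {morph (f' i)^~ c : u v / u + v} by have [] := f_compl i.
have fe s c : f' i s c *[g i] e i = 0.
  by rewrite mulf fgE ee subrr gmul0r.
(* Right multiplication by [f' i s c] sends [a] and [b] into [e M (1 - e)], where additivity is
   known. *)
have x_right d s c : f' i (x *[d] s) c = f' i ((a + b) *[d] s) c.
  rewrite -!compl_mulA; apply: nmult_inj.
  rewrite (nmultDl _ _ ea eb ex xab) gmulDl.
  by apply/esym/(@nmultD_12 i); rewrite -?gmulA ?ea ?eb // gmulA fe gmul0r.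
have xe : e i *[g i] (x - (a + b)) *[g i] e i = 0.
  apply: corner0 => m d c; rewrite gmulBr gmulDr ea eb ex.
  rewrite !gmulA gmulBl (morphDB (f'D c)) x_right.
  by rewrite subrr.
rewrite -xab; congr phi; apply/esym/subr0_eq.
move: xe; rewrite gmulBr gmulDr ea eb ex => xe.
(* The difference has no part in [e M e], so it equals its complement part, which vanishes too. *)
rewrite -[LHS]subr0 -xe -f'gE (morphDB (f'D _)).
by rewrite (nmult_add_compl ea eb xab) subrr.
Qed.

Lemma nmultD : {morph phi : x y / x + y}.
Proof.
move=> a b; have [x xab] := nmult_add_exists a b.
rewrite -xab; congr phi; apply/esym/gmul_inj_l => i d m c.
have stable := idem_mulA i d m; apply: nmult_inj.
rewrite gmulDr (nmultDr _ stable xab).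
by apply/esym/(@nmultD_1 i); rewrite -[LHS]gmulA stable.
Qed.

End NMultIsomorphism.

Theorem theorem4p1 (n : nat) (hn : (1 < n)%N)
    (M Gam : zmodType) (R : gammaRing M Gam)
    (Lambda : Type) (e : Lambda -> M) (g : Lambda -> Gam)
    (he : forall i : Lambda, gidempotent R (g i) (e i))
    (f : Lambda -> Gam -> M -> M) (f' : Lambda -> M -> Gam -> M)
    (h1 : forall i : Lambda, gcomplement R (g i) (e i) (f i) (f' i))
    (h2 : forall x : M, gmulset R [set x] setT setT = [set 0] -> x = 0)
    (h3 : forall x : M,
       (forall i : Lambda,
          gmulset R (gmulset R [set e i] setT setT) setT [set x] = [set 0]) ->
       x = 0)
    (h4 : forall (i : Lambda) (x : M),
       (forall (m : M) (b c : Gam),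
          f' i (gmul R (gmul R (gmul R (e i) (g i) x) (g i) (e i)) b m) c = 0) ->
       gmul R (gmul R (e i) (g i) x) (g i) (e i) = 0)
    (G Del : zmodType) (S : gammaRing G Del)
    (phi : M -> G) (psi : Gam -> Del)
    (hphi : nmult_isomorphism n R S phi psi) :
  {morph phi : x y / x + y}.
Proof.
apply: (nmultD hn hphi he h1 _ _ h4) => x x0.
- exact/h2/gmulset1l_eq0.
- by apply: h3 => i; apply: gmulset_ideal_eq0; apply: x0.
Qed.
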